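(* Let $\mathcal{Y}\in\mathbb{R}^{n_1\times n_2\times n_3}$ have tubal rank at most $r$, let $\Phi=\phi\circ\mathrm{vec}$ with $\phi\in\mathbb{R}^{m\times n_1n_2n_3}$ of full row rank, $\Phi^{-1}$ its Moore–Penrose pseudo-inverse, and $\mathbf b=\Phi(\mathcal{Y})$. Run either version (LRAP4TS or ELRAP4TS) of the algorithm described in the context. Then for every iteration index $k\ge1$ reached by the algorithm, $$\|\mathcal{R}_k\|_F\le\Big(\sqrt{1-\tfrac{1}{\min(n_1,n_2)}}\Big)^{k-1}\,\|\Phi^{-1}(\mathbf b)\|_F .$$
   Context: Notation: t-product $*$, conjugate transpose ${}^*$ and t-SVD of third-order tensors as usual: the t-product multiplies frontal slices in the Fourier domain (DFT along the third mode); the t-SVD $\mathcal{A}=\mathcal{U}*\mathcal{S}*\mathcal{V}^*$ has $\mathcal{U},\mathcal{V}$ orthogonal and $\mathcal{S}$ f-diagonal (diagonal frontal slices), obtained from SVDs of the Fourier-domain slices with singular values in nonincreasing order. Tubal rank = number of nonzero singular tubes $\mathcal{S}(i,i,:)$. $\Phi^{-1}\Phi$ is the orthogonal projector of $\mathbb{R}^{n_1\times n_2\times n_3}$ onto the orthogonal complement of $\ker\Phi$, and $\Phi\Phi^{-1}$ is the identity on $\mathbb{R}^m$. Algorithm (integer $s\ge1$ given): set $\mathcal{R}_0=\Phi^{-1}\Phi(\mathcal{Y})$, $\mathcal{R}_1=\mathcal{R}_0$, $\mathcal{X}_0=0$, $\widehat{\mathcal{Y}}_0=0$. For $k=1,2,\dots,\lceil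 r/s\rceil$ (stop if $\mathcal{R}_k=0$): Step 1: compute the t-SVD $\mathcal{R}_k=\mathcal{U}_k*\mathcal{S}_k*\mathcal{V}_k^*$ and set $\mathcal{M}_{k,j}=\mathcal{U}_k(:,j,:)*\frac{\mathcal{S}_k(j,j,:)}{\|\mathcal{S}_k(j,j,:)\|_F}*\mathcal{V}_k(:,j,:)^*$, $j=1,\dots,s$. Step 2/3, standard version (LRAP4TS): let $\theta^k\in\mathbb{R}^{sk}$ minimize $\|\sum_{i=1}^k\sum_{j=1}^s\theta_{i,j}\Phi^{-1}\Phi(\mathcal{M}_{i,j})-\mathcal{R}_0\|_F^2$, set $\mathcal{X}_k=\sum_{i,j}\theta^k_{i,j}\Phi^{-1}\Phi(\mathcal{M}_{i,j})$. Economic version (ELRAP4TS): let $(\alpha_0^k,\dots,\alpha_s^k)\in\mathbb{R}^{s+1}$ minimize $\|\alpha_0\mathcal{X}_{k-1}+\sum_{j=1}^s\alpha_j\Phi^{-1}\Phi(\mathcal{M}_{k,j})-\mathcal{R}_0\|_F^2$, set $\mathcal{X}_k=\alpha_0^k\mathcal{X}_{k-1}+\sum_j\alpha_j^k\Phi^{-1}\Phi(\mathcal{M}_{k,j})$ and $\widehat{\mathcal{Y}}_k=\alpha_0^k\widehat{\mathcal{Y}}_{k-1}+\sum_j\alpha^k_j\mathcal{M}_{k,j}$. In both versions set $\mathcal{R}_{k+1}=\Phi^{-1}\Phi(\mathcal{Y})-\mathcal{X}_k$. Output: $\mathcal{M}(\theta^k)=\sum_{i,j}\theta^k_{i,j}\mathcal{M}_{i,j}$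 (standard) or $\widehat{\mathcal{Y}}_k$ (economic). *)

(* Defs.v *)
From HB Require Import structures.
From mathcomp Require Import all_boot all_order all_algebra.
From mathcomp Require Import reals trigo.

Set Implicit Arguments.
Unset Strict Implicit.
Unset Printing Implicit Defensive.

Import Order.TTheory GRing.Theory Num.Theory.
Local Open Scope ring_scope.

Section Tensors.
Variable R : realType.

(* A third-order tensor of size a x b x c: c frontal slices a x b. *)
Definition tensor (a b c : nat) := {ffun 'I_c -> 'M[R]_(a, b)}.

Definition mxe a b (A : 'M[R]_(a, b)) (i j : nat) : R :=
  match @insub _ (fun x => x < a)%N 'I_a i, @insub _ (fun x => x < b)%N 'I_b j with
  | Some i', Some j' => A i' j'
  | _, _ => 0
  end.

(* t-product: block-circulant convolution of frontal slices
   (equivalently: slice-wise product in the Fourier domain) *)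
Definition tprod a b d c (A : tensor a b c) (B : tensor b d c) : tensor a d c :=
  [ffun k : 'I_c => \sum_(l < c) \sum_(l' < c | ((l + l') %% c)%N == val k)
                      A l *m B l'].

(* conjugate transpose: A^*(:,:,1)=A(:,:,1)^T, A^*(:,:,k)=A(:,:,n3+2-k)^T *)
Definition ttr a b c (A : tensor a b c) : tensor b a c :=
  [ffun k : 'I_c => \sum_(l < c | ((val k + l) %% c)%N == 0%N) (A l)^T].

Definition tid a c : tensor a a c :=
  [ffun k : 'I_c => if val k == 0%N then 1%:M else 0].

Definition torth a c (U : tensor a a c) : Prop :=
  tprod (ttr U) U = tid a c /\ tprod U (ttr U) = tid a c.

Definition fdiag a b c (S : tensor a b c) : Prop :=
  forall k i j, val i <> val j -> S k i j = 0.

(* real and imaginary parts of the DFT (along mode 3) of the tube S(j,j,:),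
   evaluated at frequency l: sum_t S(j,j,t) exp(-2 pi i t l / c) *)
Definition dft_re a b c (S : tensor a b c) (j : nat) (l : 'I_c) : R :=
  \sum_(t < c) mxe (S t) j j * cos (2 * pi * (t * l)%:R / c%:R).
Definition dft_im a b c (S : tensor a b c) (j : nat) (l : 'I_c) : R :=
  - \sum_(t < c) mxe (S t) j j * sin (2 * pi * (t * l)%:R / c%:R).

(* t-SVD: A = U * S * V^*, U, V orthogonal, S f-diagonal, and in the Fourier
   domain the diagonal of each slice of S consists of the singular values
   (real, nonnegative) in nonincreasing order *)
Definition tsvd a b c (A : tensor a b c) (U : tensor a a c) (S : tensor a b c)
  (V : tensor b b c) : Prop :=
  [/\ A = tprod (tprod U S) (ttr V), torth U, torth V, fdiag S &
      forall l : 'I_c, forall j j' : nat, (j < minn a b)%N -> (j' < minn a b)%N ->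
        [/\ dft_im S j l = 0, 0 <= dft_re S j l &
            (j <= j')%N -> dft_re S j' l <= dft_re S j l]].

Definition tube a b c (S : tensor a b c) (j : nat) : 'I_c -> R :=
  fun t => mxe (S t) j j.

Definition tubal_rank_le a b c (A : tensor a b c) (r : nat) : Prop :=
  exists U S V, tsvd A U S V /\ forall j, (r <= j)%N -> forall t, tube S j t = 0.

Definition fnorm a b c (A : tensor a b c) : R :=
  Num.sqrt (\sum_(k < c) \sum_(i < a) \sum_(j < b) (A k i j) ^+ 2).

Definition tube_norm a b c (S : tensor a b c) (j : nat) : R :=
  Num.sqrt (\sum_(t < c) (tube S j t) ^+ 2).

Definition lat a b c (A : tensor a b c) (j : nat) : tensor a 1 c :=
  [ffun k => \matrix_(i < a, _ < 1) mxe (A k) i j].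

(* M_{j} = U(:,j,:) * S(j,j,:)/||S(j,j,:)||_F * V(:,j,:)^*   (j is 0-based) *)
Definition Mrank1 a b c (U : tensor a a c) (S : tensor a b c) (V : tensor b b c)
  (j : nat) : tensor a b c :=
  tprod (tprod (lat U j) [ffun t => (tube S j t / tube_norm S j)%:M])
        (ttr (lat V j)).

Lemma vec_dim a b c : (c * (a * b) = a * b * c)%N.
Proof. by rewrite mulnC. Qed.

Definition tvec a b c (A : tensor a b c) : 'cV[R]_(a * b * c) :=
  castmx (vec_dim a b c, erefl 1%N)
    (mxvec (\matrix_(k < c, q < a * b) (mxvec (A k)) 0 q))^T.

Definition tunvec a b c (v : 'cV[R]_(a * b * c)) : tensor a b c :=
  let M : 'M[R]_(c, a * b) :=
    vec_mx (castmx (esym (vec_dim a b c), erefl 1%N) v)^T in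
  [ffun k => vec_mx (row k M)].

Definition is_pinv m n (phi : 'M[R]_(m, n)) (psi : 'M[R]_(n, m)) : Prop :=
  [/\ phi *m psi *m phi = phi, psi *m phi *m psi = psi,
      (phi *m psi)^T = phi *m psi & (psi *m phi)^T = psi *m phi].

Definition PhiOp m a b c (phi : 'M[R]_(m, a * b * c)) (A : tensor a b c)
  : 'cV[R]_m := phi *m tvec A.
Definition PhiInv m a b c (psi : 'M[R]_(a * b * c, m)) (v : 'cV[R]_m)
  : tensor a b c := tunvec (psi *m v).
Definition Pproj m a b c (phi : 'M[R]_(m, a * b * c)) psi (A : tensor a b c)
  : tensor a b c := PhiInv psi (PhiOp phi A).

Definition ceil_div (r s : nat) : nat := ((r + s.-1) %/ s)%N.

Definition iter_done a b c (Rs : nat -> tensor a b c) (K k : nat) : Prop :=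
  [/\ (1 <= k)%N, (k <= K)%N & forall i, (1 <= i)%N -> (i <= k)%N -> Rs i <> 0].

Definition LRAP4TS_run m a b c (phi : 'M[R]_(m, a * b * c)) psi
  (Y : tensor a b c) (r s : nat)
  (Rs : nat -> tensor a b c) (Us : nat -> tensor a a c) (Ss : nat -> tensor a b c)
  (Vs : nat -> tensor b b c) (Xs : nat -> tensor a b c)
  (theta : nat -> nat -> nat -> R) : Prop :=
  let R0 := Pproj phi psi Y in
  let comb k (th : nat -> nat -> R) : tensor a b c :=
    \sum_(1 <= i < k.+1) \sum_(j < s)
       th i j *: Pproj phi psi (Mrank1 (Us i) (Ss i) (Vs i) j) in
  [/\ Rs 1%N = R0, Xs 0%N = 0 &
      forall k, iter_done Rs (ceil_div r s) k ->
      [/\ tsvd (Rs k) (Us k) (Ss k) (Vs k),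
          (forall th, fnorm (comb k (theta k) - R0) <= fnorm (comb k th - R0)),
          Xs k = comb k (theta k) &
          Rs k.+1 = R0 - Xs k]].

(* ELRAP4TS, economic version (alpha k 0 = alpha_0, alpha k j.+1 = alpha_{j+1}) *)
Definition ELRAP4TS_run m a b c (phi : 'M[R]_(m, a * b * c)) psi
  (Y : tensor a b c) (r s : nat)
  (Rs : nat -> tensor a b c) (Us : nat -> tensor a a c) (Ss : nat -> tensor a b c)
  (Vs : nat -> tensor b b c) (Xs Yh : nat -> tensor a b c)
  (alpha : nat -> nat -> R) : Prop :=
  let R0 := Pproj phi psi Y in
  let comb k (al : nat -> R) : tensor a b c :=
    al 0%N *: Xs k.-1 + \sum_(j < s)
       al j.+1 *: Pproj phi psi (Mrank1 (Us k) (Ss k) (Vs k) j) in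
  let combY k (al : nat -> R) : tensor a b c :=
    al 0%N *: Yh k.-1 + \sum_(j < s) al j.+1 *: Mrank1 (Us k) (Ss k) (Vs k) j in
  [/\ Rs 1%N = R0, Xs 0%N = 0, Yh 0%N = 0 &
      forall k, iter_done Rs (ceil_div r s) k ->
      [/\ tsvd (Rs k) (Us k) (Ss k) (Vs k),
          (forall al, fnorm (comb k (alpha k) - R0) <= fnorm (comb k al - R0)),
          Xs k = comb k (alpha k),
          Yh k = combY k (alpha k) &
          Rs k.+1 = R0 - Xs k]].

End Tensors.

(* Main.v *)
(** Multiplication by orthogonal tensors preserves the Frobenius inner product,
    so if A = U * S * V^* then ||A||^2 is the sum of the squared norms of the
    min(n1, n2) singular tubes, while the normalized leading term M satisfies
    ||M|| <= 1 and <M, A> = ||S(1,1,:)||.  The singular values are ordered in each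
    Fourier slice, hence by Parseval the leading tube is the longest one and
    ||A||^2 <= min(n1, n2) <M, A>^2.  The residual R_k lies in the range of the
    orthogonal projector P, so <P M, R_k> = <M, R_k>, and R_k - <M, R_k> P M is a
    competitor in both least-squares problems: each iteration shrinks the
    squared norm of the residual by the factor 1 - 1 / min(n1, n2). *)

Require Import Defs.
From HB Require Import structures.
From mathcomp Require Import all_boot all_order all_algebra.
From mathcomp Require Import reals trigo ring lra.

Set Implicit Arguments.
Unset Strict Implicit.
Unset Printing Implicit Defensive.

Import Order.TTheory GRing.Theory Num.Theory.
Local Open Scope ring_scope.

(** * Parseval's identity for the real and imaginary parts of the DFT of a tube *)

Section Parseval.
Variable R : realType.

Lemma sum_cos_eq0 (c d : nat) : (0 < d < c)%N ->
  \sum_(l < c) cos (2 * pi * (d * l)%:R / c%:R : R) = 0.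
Proof.
case/andP=> d0 dc.
have c0 : c%:R != 0 :> R by rewrite pnatr_eq0 -lt0n (ltn_trans d0 dc).
have cp : 0 < c%:R :> R by rewrite lt0r c0 ler0n.
set h : R := pi * d%:R / c%:R.
have sh : 0 < sin h.
  apply: sin_gt0_pi; rewrite /h !mulr_gt0 ?invr_gt0 ?pi_gt0 ?ltr0n ?(ltn_trans d0 dc) //=.
  by rewrite ltr_pdivrMr // ltr_pM2l ?pi_gt0 // ltr_nat.
(* 2 sin h cos (2 l h) telescopes *)
have tele n : 2 * sin h * \sum_(l < n) cos (2 * pi * (d * l)%:R / c%:R)
    = sin (2 * n%:R * h - h) + sin h.
  elim: n => [|n IH]; first by rewrite big_ord0 !mulr0 mul0r add0r sinN addNr.
  rewrite big_ord_recr /= mulrDr IH.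
  have -> : 2 * pi * (d * n)%:R / c%:R = 2 * n%:R * h :> R.
    by rewrite /h natrM; field.
  have -> : 2 * n.+1%:R * h - h = 2 * n%:R * h + h.
    by rewrite -(natr1 n); ring.
  by rewrite sinB sinD; ring.
have := tele c.
(* At [n = c] the argument is [- h] up to [d] full periods, so the two sines cancel; [sin h > 0] can
   then be divided out. *)
have -> : 2 * c%:R * h - h = - h + pi *+ 2 *+ d.
  by rewrite /h -mulr_natr -(mulr_natr pi 2); field.
rewrite -addrC.
have -> x : sin (x + pi *+ 2 *+ d) = sin x :> R.
  elim: (d) x => [|n IH] x; first by rewrite mulr0n addr0.
  by rewrite mulrSr addrA sinD2pi IH.
rewrite sinN subrr => /eqP; rewrite !mulf_eq0 pnatr_eq0 /= (gt_eqF sh) /=.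
by move/eqP.
Qed.

Lemma sum_cos_sub (c : nat) (t u : 'I_c) :
  \sum_(l < c) cos (2 * pi * (t * l)%:R / c%:R - 2 * pi * (u * l)%:R / c%:R : R)
  = c%:R *+ (t == u).
Proof.
(* Evenness of the cosine gives the symmetry; the order makes [t - u] a genuine difference of
   naturals. *)
wlog le_ut : t u / (u <= t)%N.
  move=> H; case: (leqP u t) => [/H //|/ltnW/H].
  rewrite eq_sym => <-; apply: eq_bigr => l _.
  by rewrite -cosN opprB.
case: eqVneq => [->|ne].
  under eq_bigr do rewrite subrr cos0.
  by rewrite sumr_const card_ord mulr1n.
rewrite mulr0n; apply: etrans (@sum_cos_eq0 c (t - u) _); last first.
  rewrite subn_gt0 ltn_neqAle eq_sym ne le_ut /=.
  exact: leq_ltn_trans (leq_subr _ _) (ltn_ord t).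
apply: eq_bigr => l _; congr cos.
by rewrite mulnBl natrB ?leq_mul2r ?le_ut ?orbT // mulrBr mulrBl.
Qed.

(** The formula for [cos (x - y)] merges both squares into one double sum over times; summing over
    frequencies first leaves only its diagonal. *)
Lemma dft_parseval (a b c : nat) (S : tensor R a b c) (j : nat) :
  \sum_(l < c) (dft_re S j l ^+ 2 + dft_im S j l ^+ 2)
  = c%:R * \sum_(t < c) tube S j t ^+ 2.
Proof.
pose w (t l : 'I_c) : R := 2 * pi * (t * l)%:R / c%:R.
transitivity (\sum_(l < c) \sum_(t < c) \sum_(u < c)
    tube S j t * tube S j u * cos (w t l - w u l)).
  apply: eq_bigr => l _; rewrite /dft_im sqrrN !expr2 !big_distrl -big_split /=.
  apply: eq_bigr => t _; rewrite !big_distrr -big_split /=.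
  by apply: eq_bigr => u _; rewrite cosB /tube /w; ring.
rewrite exchange_big /= mulr_sumr; apply: eq_bigr => t _.
rewrite exchange_big /= (bigD1 t) //= [X in _ + X]big1 ?addr0 => [|u ne];
  rewrite -mulr_sumr sum_cos_sub.
  by rewrite eqxx mulr1n mulrC expr2.
by rewrite eq_sym (negPf ne) mulr0.
Qed.

End Parseval.

(** * Algebra of the t-product *)

Section TubalAlgebra.
Variables (R : realType) (n : nat).
Notation c := n.+1.

(** For [c = n.+1] the addition of ['I_c] is that of Z/c, so the inner sum of [tprod] has exactly
    one term. *)
Lemma Zp_eq_addmod (l l' k : 'I_c) : (((l + l') %% c)%N == val k) = (l' == k - l).
Proof.
have -> : (((l + l') %% c)%N == val k) = (l + l' == k) by [].
by rewrite eq_sym eq_sym [RHS]eq_sym subr_eq addrC eq_sym.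
Qed.

Lemma tprodE a b d (A : tensor R a b c) (B : tensor R b d c) k :
  tprod A B k = \sum_l A l *m B (k - l).
Proof.
rewrite ffunE; apply: eq_bigr => l _.
by under eq_bigl do rewrite Zp_eq_addmod; rewrite big_pred1_eq.
Qed.

Lemma ttrE a b (A : tensor R a b c) k : ttr A k = (A (- k))^T.
Proof.
rewrite ffunE (eq_bigl (pred1 (- k))) ?big_pred1_eq // => l /=.
by have := Zp_eq_addmod k l 0; rewrite sub0r.
Qed.

Lemma tprodA a b d e (A : tensor R a b c) (B : tensor R b d c) (D : tensor R d e c) :
  tprod A (tprod B D) = tprod (tprod A B) D.
Proof.
apply/ffunP => k; rewrite !tprodE.
under eq_bigr do rewrite tprodE mulmx_sumr.
under [RHS]eq_bigr do rewrite tprodE mulmx_suml.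
rewrite [RHS]exchange_big; apply: eq_bigr => l _ /=.
rewrite (reindex_inj (addrI (- l))) /=; apply: eq_bigr => q _.
by rewrite mulmxA -!(addrC q) opprD opprK addrA addrAC addrNK.
Qed.

Lemma tprod1t a b (A : tensor R a b c) : tprod (tid R a c) A = A.
Proof.
apply/ffunP => k; rewrite tprodE (bigD1 0) //= ffunE /= mul1mx subr0.
rewrite big1 ?addr0 // => l ne; rewrite ffunE.
have -> : (val l == 0%N) = (l == 0) by [].
by rewrite (negPf ne) mul0mx.
Qed.

Lemma tprodt1 a b (A : tensor R a b c) : tprod A (tid R b c) = A.
Proof.
apply/ffunP => k; rewrite tprodE (bigD1 k) //= ffunE subrr /= mulmx1.
rewrite big1 ?addr0 // => l ne; rewrite ffunE.
have -> : (val (k - l) == 0%N) = (k - l == 0) by [].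
by rewrite subr_eq0 eq_sym (negPf ne) mulmx0.
Qed.

End TubalAlgebra.

(** * Frobenius inner product and invariance under orthogonal tensors *)

Section InnerProduct.
Variable R : realType.

Definition tdot a b c (A B : tensor R a b c) : R := \sum_k \tr ((A k)^T *m B k).

Lemma tdotE a b c (A B : tensor R a b c) :
  tdot A B = \sum_k \sum_i \sum_j A k i j * B k i j.
Proof.
apply: eq_bigr => k _; rewrite [RHS]exchange_big; apply: eq_bigr => j _ /=.
by rewrite !mxE; apply: eq_bigr => i _; rewrite mxE.
Qed.

Lemma tdot_ge0 a b c (A : tensor R a b c) : 0 <= tdot A A.
Proof.
by rewrite tdotE; do 3![apply: sumr_ge0 => ? _]; rewrite -expr2 sqr_ge0.
Qed.

Lemma fnormE a b c (A : tensor R a b c) : fnorm A = Num.sqrt (tdot A A).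
Proof. by rewrite tdotE. Qed.

Lemma fnorm_ge0 a b c (A : tensor R a b c) : 0 <= fnorm A.
Proof. exact: sqrtr_ge0. Qed.

Lemma sqr_fnorm a b c (A : tensor R a b c) : fnorm A ^+ 2 = tdot A A.
Proof. by rewrite fnormE sqr_sqrtr // tdot_ge0. Qed.

Lemma fnormN a b c (A : tensor R a b c) : fnorm (- A) = fnorm A.
Proof.
rewrite !fnormE !tdotE; congr Num.sqrt.
by do 3![apply: eq_bigr => ? _]; rewrite ffunE mxE mulrNN.
Qed.

Lemma sqr_fnormBZ a b c (A B : tensor R a b c) (t : R) :
  fnorm (A - t *: B) ^+ 2 = fnorm A ^+ 2 - 2 * t * tdot B A + t ^+ 2 * fnorm B ^+ 2.
Proof.
rewrite !sqr_fnorm !tdotE !mulr_sumr -sumrB -big_split; apply: eq_bigr => k _ /=.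
rewrite !mulr_sumr -sumrB -big_split; apply: eq_bigr => i _ /=.
rewrite !mulr_sumr -sumrB -big_split; apply: eq_bigr => j _ /=.
by rewrite !ffunE !mxE; ring.
Qed.

(** The substitution [l -> - l] absorbs the reversal of slices in [ttr], and a shift of [k] by [l]
    aligns the remaining indices. *)
Lemma tdot_tprodl a b d n (U : tensor R a b n.+1) (A : tensor R b d n.+1)
    (B : tensor R a d n.+1) :
  tdot (tprod U A) B = tdot A (tprod (ttr U) B).
Proof.
rewrite /tdot.
under eq_bigr do rewrite tprodE linear_sum mulmx_suml linear_sum.
under [RHS]eq_bigr do rewrite tprodE mulmx_sumr linear_sum.
rewrite exchange_big /= [RHS]exchange_big (reindex_inj oppr_inj) /=.
apply: eq_bigr => l _; rewrite (reindex_inj (addIr (- l))) /=.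
apply: eq_bigr => k _; rewrite ttrE opprK addrNK.
by rewrite trmx_mul mulmxA.
Qed.

Lemma tdot_tprodr a b d n (V : tensor R b d n.+1) (A : tensor R a d n.+1)
    (B : tensor R a b n.+1) :
  tdot (tprod A (ttr V)) B = tdot A (tprod B V).
Proof.
rewrite /tdot.
under eq_bigr do rewrite tprodE linear_sum mulmx_suml linear_sum.
under [RHS]eq_bigr do rewrite tprodE mulmx_sumr linear_sum.
rewrite exchange_big /=; do 2![apply: eq_bigr => ? _].
by rewrite ttrE opprB trmx_mul trmxK -mulmxA mxtrace_mulC -mulmxA.
Qed.

Lemma tdot_orth a b n (U : tensor R a a n.+1) (V : tensor R b b n.+1)
    (A B : tensor R a b n.+1) : torth U -> torth V ->
  tdot (tprod (tprod U A) (ttr V)) (tprod (tprod U B) (ttr V)) = tdot A B.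
Proof.
case=> UU _ [VV _].
by rewrite tdot_tprodr -tprodA VV tprodt1 tdot_tprodl tprodA UU tprod1t.
Qed.

End InnerProduct.

(** * Vectorization as an isometry *)

Section Vectorization.
Variables (R : realType) (a b c : nat).
Implicit Types A B : tensor R a b c.

Lemma tunvecK (v : 'cV[R]_(a * b * c)) : tvec (tunvec v) = v.
Proof.
rewrite /tvec /tunvec.
set M := vec_mx _.
have -> : \matrix_(k < c, q < a * b)
    mxvec ([ffun k0 => vec_mx (row k0 M)] k) 0 q = M.
  by apply/matrixP => k q; rewrite mxE ffunE vec_mxK mxE.
by rewrite /M vec_mxK trmxK castmxKV.
Qed.

Lemma tdot_tvec A B : tdot A B = ((tvec A)^T *m tvec B) 0 0.
Proof.
have dot_cast p q (e : p = q) (v w : 'cV[R]_p) :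
    (castmx (e, erefl 1%N) v)^T *m castmx (e, erefl 1%N) w = v^T *m w.
  by case: q / e; rewrite !castmx_id.
have dot_mxvec p q (M N : 'M[R]_(p, q)) :
    (mxvec M *m (mxvec N)^T) 0 0 = \sum_i \sum_j M i j * N i j.
  rewrite mxE pair_bigA (reindex _ (curry_mxvec_bij p q)) /=.
  by apply: eq_bigr => -[i j] _ /=; rewrite mxE !mxvecE.
rewrite dot_cast trmxK dot_mxvec tdotE; apply: eq_bigr => k _.
rewrite -dot_mxvec mxE; apply: eq_bigr => q _.
by rewrite !mxE.
Qed.

End Vectorization.

(** * The orthogonal projector attached to the pseudo-inverse *)

Section Projection.
Variables (R : realType) (a b c m : nat).
Variables (phi : 'M[R]_(m, a * b * c)) (psi : 'M[R]_(a * b * c, m)).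
Hypothesis pinv : is_pinv phi psi.
Implicit Types A B : tensor R a b c.
Notation P := (Pproj phi psi).

Lemma tvec_Pproj A : tvec (P A) = psi *m phi *m tvec A.
Proof. by rewrite /Pproj /PhiInv tunvecK mulmxA. Qed.

Lemma tdot_Pproj A B : tdot (P A) B = tdot A (P B).
Proof.
case: pinv => _ _ _ sym.
by rewrite !tdot_tvec !tvec_Pproj trmx_mul sym mulmxA.
Qed.

Lemma Pproj_id A : P (P A) = P A.
Proof.
case: pinv => _ idem _ _.
by rewrite {1}/Pproj /PhiInv /PhiOp tvec_Pproj !mulmxA idem -mulmxA.
Qed.

(** Expand the square of the norm of [A - P A], which is nonnegative, using that [<P A, A>] is the
    squared norm of [P A]. *)
Lemma fnorm_Pproj A : fnorm (P A) <= fnorm A.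
Proof.
rewrite -(@ler_pXn2r _ 2) ?nnegrE ?fnorm_ge0 //.
have := sqr_ge0 (fnorm (A - 1 *: P A)); rewrite sqr_fnormBZ.
rewrite !sqr_fnorm [tdot (P A) (P A)]tdot_Pproj Pproj_id -tdot_Pproj; lra.
Qed.

Lemma tunvecD (v w : 'cV[R]_(a * b * c)) : tunvec (v + w) = tunvec v + tunvec w.
Proof.
apply/ffunP => k; rewrite !ffunE; apply/matrixP => i j.
by rewrite !(mxE, castmxE).
Qed.

Lemma tunvecZ t (v : 'cV[R]_(a * b * c)) : tunvec (t *: v) = t *: tunvec v.
Proof.
apply/ffunP => k; rewrite !ffunE; apply/matrixP => i j.
by rewrite !(mxE, castmxE).
Qed.

Lemma tvecD A B : tvec (A + B) = tvec A + tvec B.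
Proof.
by rewrite /tvec; apply/matrixP => i j; rewrite !(mxE, castmxE, ffunE).
Qed.

Lemma tvecZ t A : tvec (t *: A) = t *: tvec A.
Proof.
by rewrite /tvec; apply/matrixP => i j; rewrite !(mxE, castmxE, ffunE).
Qed.

Lemma PprojD A B : P (A + B) = P A + P B.
Proof. by rewrite /Pproj /PhiInv /PhiOp tvecD !mulmxDr tunvecD. Qed.

Lemma PprojZ t A : P (t *: A) = t *: P A.
Proof. by rewrite /Pproj /PhiInv /PhiOp tvecZ -!scalemxAr tunvecZ. Qed.

Lemma Pproj0 : P 0 = 0.
Proof. by have := PprojZ 0 0; rewrite !scale0r. Qed.

Lemma Pproj_sum I (s : seq I) (F : I -> tensor R a b c) :
  P (\sum_(i <- s) F i) = \sum_(i <- s) P (F i).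
Proof. exact: (big_morph P PprojD Pproj0). Qed.

End Projection.

(** * Singular tubes and the leading rank-one term *)

Section TubalSVD.
Variable R : realType.

Lemma sqr_tube_norm a b c (S : tensor R a b c) j :
  tube_norm S j ^+ 2 = \sum_t tube S j t ^+ 2.
Proof. by rewrite sqr_sqrtr // sumr_ge0 // => t _; rewrite sqr_ge0. Qed.

Lemma mxe_ord a b (A : 'M[R]_(a, b)) (i : 'I_a) (j : 'I_b) : mxe A i j = A i j.
Proof. by rewrite /mxe !valK. Qed.

Lemma sqr_fnorm_fdiag a b c (S : tensor R a b c) : fdiag S ->
  fnorm S ^+ 2 = \sum_(q < minn a b) tube_norm S q ^+ 2.
Proof.
move=> dS; rewrite sqr_fnorm tdotE.
under [RHS]eq_bigr do rewrite sqr_tube_norm.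
rewrite [RHS]exchange_big; apply: eq_bigr => k _ /=.
rewrite (big_ord_widen a (fun q => tube S q k ^+ 2)) ?geq_minl //.
rewrite [RHS]big_mkcond /=; apply: eq_bigr => i _.
rewrite leq_min ltn_ord /=; case: (ltnP i b) => ib; last first.
  rewrite big1 // => j _; rewrite dS ?mulr0 // => eij.
  by move: (ltn_ord j); rewrite -[nat_of_ord j]eij ltnNge ib.
rewrite (bigD1 (Ordinal ib)) //= big1 ?addr0 => [|j ne]; last first.
  by rewrite dS ?mulr0 // => eij; case/eqP: ne; apply: val_inj.
by rewrite /tube -[X in mxe _ _ X]/(val (Ordinal ib)) mxe_ord expr2.
Qed.

(** [tsvd] orders the tubes only frequency by frequency. After multiplication by [c], Parseval turns
    both sides into sums over frequencies, where imaginary parts vanish and nonnegativity lets the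
    order pass to squares. *)
Lemma tube_norm_le0 a b c (A : tensor R a b c) U S V q :
  tsvd A U S V -> (q < minn a b)%N -> tube_norm S q ^+ 2 <= tube_norm S 0 ^+ 2.
Proof.
case=> _ _ _ _ sv qab; rewrite !sqr_tube_norm.
case: c => [|n] in A U S V sv *; first by rewrite !big_ord0.
have n0 : 0 < n.+1%:R :> R by rewrite ltr0n.
rewrite -(ler_pM2l n0) -!dft_parseval; apply: ler_sum => l _.
have [-> _ le] := sv l 0%N q (leq_ltn_trans (leq0n _) qab) qab.
have [-> ge0 _] := sv l q q qab qab.
by rewrite expr0n !addr0 ler_pXn2r ?nnegrE ?le // (le_trans ge0 (le _)).
Qed.

(** This has the format of [S], so that the leading term is written with the full [U] and [V] and
    [tdot_orth] applies to it. *)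
Definition leading_tube a b c (S : tensor R a.+1 b.+1 c) : tensor R a.+1 b.+1 c :=
  [ffun t => (tube S 0 t / tube_norm S 0) *: delta_mx 0 0].

(** A first lateral slice is a product with a basis vector, and the two basis vectors multiply to
    [delta_mx 0 0]. *)
Lemma Mrank1_leading a b n (U : tensor R a.+1 a.+1 n.+1) (S : tensor R a.+1 b.+1 n.+1)
    (V : tensor R b.+1 b.+1 n.+1) :
  Mrank1 U S V 0 = tprod (tprod U (leading_tube S)) (ttr V).
Proof.
have latE p (W : tensor R p.+1 p.+1 n.+1) l : lat W 0 l = W l *m delta_mx 0 0.
  rewrite -colE; apply/matrixP => i j; rewrite ffunE !mxE.
  by rewrite -[0%N]/(nat_of_ord (@ord0 p)) mxe_ord.
apply/ffunP => k; rewrite !tprodE; apply: eq_bigr => l _.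
rewrite !tprodE !mulmx_suml; apply: eq_bigr => q _.
rewrite !ttrE !latE !ffunE mul_mx_scalar trmx_mul trmx_delta mulmxA.
rewrite -!scalemxAl -!scalemxAr -[_ *m _ *m delta_mx 0 0]mulmxA mul_delta_mx.
by rewrite scalemxAl.
Qed.

Lemma tdot_leading a b c (S B : tensor R a.+1 b.+1 c) :
  tdot (leading_tube S) B = (\sum_t tube S 0 t * tube B 0 t) / tube_norm S 0.
Proof.
rewrite tdotE big_distrl; apply: eq_bigr => t _ /=.
rewrite (bigD1 ord0) //= [X in _ + X]big1 ?addr0 => [|i ne]; last first.
  by rewrite big1 // => j _; rewrite ffunE !mxE (negPf ne) mulr0 mul0r.
rewrite (bigD1 ord0) //= big1 ?addr0 => [|j ne]; last first.
  by rewrite ffunE !mxE (negPf ne) andbF mulr0 mul0r.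
rewrite ffunE !mxE !eqxx mulr1 mulrAC; congr (_ * _ / _).
by rewrite -mxe_ord.
Qed.

Lemma fnorm_leading a b c (S : tensor R a.+1 b.+1 c) : fnorm (leading_tube S) <= 1.
Proof.
(* The quotient is 1, or 0 for a null leading tube, since [0^-1 = 0]. *)
have -> : fnorm (leading_tube S) = tube_norm S 0 / tube_norm S 0.
  apply/eqP; rewrite -(@eqrXn2 _ 2) ?fnorm_ge0 ?divr_ge0 ?sqrtr_ge0 //.
  rewrite sqr_fnorm tdot_leading [X in _ == X]expr2 mulrACA -expr2 mulrA.
  rewrite sqr_tube_norm; apply/eqP; congr (_ / _).
  rewrite big_distrl; apply: eq_bigr => t _ /=.
  rewrite expr2 -mulrA; congr (_ * _).
  rewrite {1}/tube -[0%N]/(nat_of_ord (@ord0 a)).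
  rewrite -[X in mxe _ _ X]/(nat_of_ord (@ord0 b)) mxe_ord.
  by rewrite ffunE !mxE !eqxx mulr1.
by have [->|nz] := eqVneq (tube_norm S 0) 0; rewrite ?mul0r ?ler01 // divff.
Qed.

End TubalSVD.

(** * Contraction of the residual in one step *)

Section Contraction.
Variables (R : realType) (a b c m : nat).
Variables (phi : 'M[R]_(m, a * b * c)) (psi : 'M[R]_(a * b * c, m)).
Hypothesis pinv : is_pinv phi psi.
Notation P := (Pproj phi psi).
Notation rho := (1 - (minn a b)%:R^-1 : R).

Lemma rho_ge0 : 0 <= rho.
Proof.
case: (minn a b) => [|n]; first by rewrite invr0 subr0 ler01.
by rewrite subr_ge0 invf_le1 ?ltr0n // ler1n.
Qed.

(* The leading rank-one term M carries at least a fraction 1 / min(a, b) of the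
   energy of A, and the step t = <M, A> removes that much of it. *)
Lemma leading_contraction A U S V : tsvd A U S V -> P A = A ->
  exists t, fnorm (A - t *: P (Mrank1 U S V 0)) <= Num.sqrt rho * fnorm A.
Proof.
move=> svd PA.
suff [t le] : exists t, fnorm (A - t *: P (Mrank1 U S V 0)) ^+ 2 <= rho * fnorm A ^+ 2.
  exists t; rewrite -(@ler_pXn2r _ 2) ?nnegrE ?mulr_ge0 ?sqrtr_ge0 ?fnorm_ge0 //.
  by rewrite exprMn (sqr_sqrtr rho_ge0).
case: (posnP c) => [c0|c_gt0].
  exists 0; rewrite scale0r subr0; move: (A); rewrite c0 => B.
  by rewrite sqr_fnorm /tdot big_ord0 mulr0.
(* With [0^-1 = 0] the factor is 1 here, so the zero step suffices. *)
case: (posnP (minn a b)) => [ab0|ab_gt0].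
  by exists 0; rewrite scale0r subr0 ab0 invr0 subr0 mul1r.
case: (svd) => AE oU oV dS _.
have le0 q := @tube_norm_le0 _ _ _ _ _ _ _ _ q svd.
exists (tube_norm S 0).
have [dot nrm nA] : [/\ tdot (Mrank1 U S V 0) A = tube_norm S 0,
    fnorm (Mrank1 U S V 0) <= 1 & fnorm A ^+ 2 = fnorm S ^+ 2].
  rewrite {}AE {svd PA le0}; move: c_gt0 ab_gt0; rewrite leq_min => + /andP[].
  case: a b c U S V oU oV dS => [//|a'] [//|b'] [//|n] U S V oU oV dS _ _ _.
  rewrite fnormE !sqr_fnorm Mrank1_leading !tdot_orth // -fnormE fnorm_leading.
  split=> //; rewrite tdot_leading.
  under eq_bigr do rewrite -expr2.
  rewrite -sqr_tube_norm.
  have [->|nz] := eqVneq (tube_norm S 0) 0; first by rewrite invr0 mulr0.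
  by rewrite expr2 mulfK.
have leA : fnorm A ^+ 2 <= (minn a b)%:R * tube_norm S 0 ^+ 2.
  rewrite nA sqr_fnorm_fdiag //.
  rewrite (le_trans (ler_sum _ (fun q _ => le0 _ (ltn_ord q)))) //.
  by rewrite sumr_const card_ord mulr_natl.
(* [P] is self-adjoint and fixes [A], so the cross term is [- 2 t^2]; with [P M] of norm at most 1
   the total is at most the squared norm of [A] minus [t^2]. *)
rewrite sqr_fnormBZ tdot_Pproj // PA dot.
have nP : fnorm (P (Mrank1 U S V 0)) ^+ 2 <= 1.
  by rewrite exprn_ile1 ?fnorm_ge0 // (le_trans (fnorm_Pproj pinv _)).
have {}leA : (minn a b)%:R^-1 * fnorm A ^+ 2 <= tube_norm S 0 ^+ 2.
  by rewrite ler_pdivrMl ?ltr0n.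
have := ler_wpM2l (sqr_ge0 (tube_norm S 0)) nP.
move: leA; rewrite mulrBl mul1r mulr1 -[2 * _ * _]mulrA -!expr2; lra.
Qed.

End Contraction.

(** * Residual decay for both versions of the algorithm *)

Theorem theorem3p1 (R : realType) (n1 n2 n3 m r s : nat)
  (Y : tensor R n1 n2 n3) (phi : 'M[R]_(m, n1 * n2 * n3))
  (psi : 'M[R]_(n1 * n2 * n3, m))
  (Rs : nat -> tensor R n1 n2 n3) (Us : nat -> tensor R n1 n1 n3)
  (Ss : nat -> tensor R n1 n2 n3) (Vs : nat -> tensor R n2 n2 n3)
  (Xs Yh : nat -> tensor R n1 n2 n3)
  (theta : nat -> nat -> nat -> R) (alpha : nat -> nat -> R) :
  (1 <= s)%N ->
  tubal_rank_le Y r ->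
  row_free phi ->
  is_pinv phi psi ->
  LRAP4TS_run phi psi Y r s Rs Us Ss Vs Xs theta \/
  ELRAP4TS_run phi psi Y r s Rs Us Ss Vs Xs Yh alpha ->
  forall k : nat,
    (1 <= k)%N -> (k <= ceil_div r s)%N ->
    (forall i, (1 <= i)%N -> (i < k)%N -> Rs i <> 0) ->
    fnorm (Rs k) <=
      Num.sqrt (1 - (minn n1 n2)%:R^-1) ^+ k.-1 *
      fnorm (PhiInv psi (PhiOp phi Y)).
Proof.
move=> s1 _ _ pinv run.
pose P := Pproj phi psi; set q := Num.sqrt _.
have distC (A B : tensor R n1 n2 n3) : fnorm (A - B) = fnorm (B - A).
  by rewrite -opprB fnormN.
have R1 : Rs 1%N = P Y by case: run => -[].
have X0 : Xs 0%N = 0 by case: run => -[].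
(* This is all that the induction needs from either version: [P] keeps fixing the iterates, and the
   new residual is at least as small as after adding any multiple of the projected leading term. *)
have step k : iter_done Rs (ceil_div r s) k.+1 ->
    [/\ tsvd (Rs k.+1) (Us k.+1) (Ss k.+1) (Vs k.+1), Rs k.+2 = P Y - Xs k.+1,
       (P (Xs k) = Xs k -> P (Xs k.+1) = Xs k.+1) &
       forall t, fnorm (Rs k.+2) <= fnorm (P Y - Xs k
         - t *: P (Mrank1 (Us k.+1) (Ss k.+1) (Vs k.+1) 0))].
  move=> done.
  pose dlt t j : R := if j == 0%N then t else 0.
  have pick t (G : nat -> tensor R n1 n2 n3) :
      \sum_(j < s) dlt t j *: G j = t *: G 0%N.
    case: (s) s1 => // s' _; rewrite big_ord_recl big1 ?addr0 // => j _.
    by rewrite scale0r.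
  case: run => [[_ _ H]|[_ _ _ H]].
  - have [svd opt XE RE] := H _ done; split=> // [_|t].
      rewrite /P XE Pproj_sum; apply: eq_bigr => i _.
      by rewrite Pproj_sum; apply: eq_bigr => j _; rewrite PprojZ Pproj_id.
    rewrite RE distC XE.
    (* The competitor reuses the previous optimal coefficients and puts [t] on the new leading term
       alone. *)
    pose th i j := if (i < k.+1)%N then theta k i j else dlt t j.
    have combE : \sum_(1 <= i < k.+2) \sum_(j < s)
        th i j *: P (Mrank1 (Us i) (Ss i) (Vs i) j)
        = Xs k + t *: P (Mrank1 (Us k.+1) (Ss k.+1) (Vs k.+1) 0).
      rewrite big_nat_recr //=; congr (_ + _); last first.
        rewrite -(pick t (fun j => P (Mrank1 (Us k.+1) (Ss k.+1) (Vs k.+1) j))).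
        by apply: eq_bigr => j _; rewrite /th ltnn.
      (* In the first iteration the old sum is empty and [Xs 0] is 0; later the run at the previous
         index gives the old iterate as a combination. *)
      case: k done @th {svd opt XE RE} => [|k] done th; first by rewrite big_geq.
      case: done => _ kK nz; have [|_ _ -> _] := H k.+1.
        by split=> // [|i i1 ik]; [exact: ltnW | apply: nz => //; exact: leqW].
      apply: eq_big_nat => i /andP[_ ik]; apply: eq_bigr => j _.
      by rewrite /th ik.
    by rewrite (le_trans (opt th)) // combE -[P Y - _ - _]addrA -opprD distC.
  - have [svd opt XE _ RE] := H _ done; split=> // [PX|t].
      move: PX; rewrite /P XE PprojD PprojZ Pproj_sum => ->.
      congr (_ + _); apply: eq_bigr => j _.
      by rewrite PprojZ Pproj_id.
    rewrite RE distC XE.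
    (* Weight 1 keeps the previous iterate whole. *)
    pose al j := if j is j'.+1 then dlt t j' else 1.
    have combE : al 0%N *: Xs k
        + \sum_(j < s) al j.+1 *: P (Mrank1 (Us k.+1) (Ss k.+1) (Vs k.+1) j)
        = Xs k + t *: P (Mrank1 (Us k.+1) (Ss k.+1) (Vs k.+1) 0).
      rewrite scale1r; congr (_ + _).
      exact: (pick t (fun j => P (Mrank1 (Us k.+1) (Ss k.+1) (Vs k.+1) j))).
    by rewrite (le_trans (opt al)) // combE -[P Y - _ - _]addrA -opprD distC.
(* The bound is strengthened by two invariants which yield [P (Rs k.+1) = Rs k.+1], as required by
   [leading_contraction]. *)
suff main k : (k.+1 <= ceil_div r s)%N ->
    (forall i, (1 <= i)%N -> (i < k.+1)%N -> Rs i <> 0) ->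
    [/\ P (Xs k) = Xs k, Rs k.+1 = P Y - Xs k & fnorm (Rs k.+1) <= q ^+ k * fnorm (P Y)].
  by case=> [//|k] _ kK nz; have [] := main k kK nz.
elim: k => [|k IH] kK nz.
  by rewrite X0 subr0 R1 expr0 mul1r /P Pproj0.
have {IH} [|i i1 ik|PX RE le] := IH; [exact: ltnW | by apply: nz => //; exact: leqW |].
have done : iter_done Rs (ceil_div r s) k.+1 by split=> //; exact: ltnW.
have [svd RE' PX' opt] := step k done.
have PR : P (Rs k.+1) = Rs k.+1.
  by move: PX; rewrite RE -scaleN1r /P PprojD PprojZ Pproj_id // => ->.
have [t le_t] := leading_contraction pinv svd PR.
split=> //; first exact: PX'.
rewrite (le_trans (opt t)) // -RE (le_trans le_t) // exprS -mulrA.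
by rewrite ler_wpM2l ?sqrtr_ge0.
Qed.
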